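(* Let $h:\mathbb R\to\mathbb R$ be a function, not identically zero, with $h(0)=0$ and satisfying: (A0) $h(x)=h(|x|)\ge0$ for all $x$; (A1) $h(x)/x$ is monotone increasing (non-strictly) for $x>0$; (A2) $h(x)/x^2$ is monotone decreasing (non-strictly) for $x>0$. Let $g:[0,\infty)\to(0,\infty)$ be a positive increasing function. Then in the unbounded forecasting game with general hedge $h$ (UFGH) Reality strongly complies with the event $$\sum_n\frac{v_n}{g(A_n)}=\infty\ \Rightarrow\ \sum_{k=1}^n\frac{x_k-m_k}{h^{-1}(g(A_k))}\ \text{ does not converge (as } n\to\infty),$$ where $A_n=\sum_{k=1}^n v_k$.
   Context: Unbounded forecasting game with general hedge $h:\mathbb R\to\mathbb R$ (UFGH): $\mathcal K_0=1$. For $n=1,2,\ldots$: Forecaster announces $m_n\in\mathbb R$ and $v_n>0$; Skeptic announces $M_n\in\mathbb R$ and $V_n\ge0$; Reality announces $x_n\in\mathbb R$; and $\mathcal K_n:=\mathcal K_{n-1}+M_n(x_n-m_n)+V_n(h(x_n-m_n)-v_n)$. All moves are public. Skeptic's collateral duty is to keep $\mathcal K_n$ non-negative; Forecaster has no duty other than making allowed moves. Under the stated conditions on $h$, the restriction of $h$ to $[0,\infty)$ is a bijection onto $[0,\infty)$, and $h^{-1}:[0,\infty)\to[0,\infty)$ denotes its inverse. A path is an infinite sequence $\xi=(m_1,v_1,x_1,m_2,v_2,x_2,\ldots)$ of allowed moves of Forecaster and Reality; $\Xi$ is the set of paths; an event is any subset of $\Xi$. For events, $E_1\Rightarrow E_2$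 denotes $E_1^c\cup E_2$. ''Converges'' means converges to a finite real limit. Write $\mu_n=(m_n,v_n)$ and $\mathfrak m_n=(M_n,V_n)$. A (deterministic) strategy of Reality is a sequence $\mathcal R=\{\mathcal R_n\}_{n\ge1}$ of functions with $x_n=\mathcal R_n(\mu_1,\mathfrak m_1,\ldots,\mu_n,\mathfrak m_n)$. By $\mathcal R$ Reality strongly complies with an event $E$ if, irrespective of the moves $\mu_n,\mathfrak m_n$, $n\ge1$, of Forecaster and Skeptic, both observing their collateral duties, when Reality plays $\mathcal R$: (i) the resulting path $(\mu_1,x_1,\mu_2,x_2,\ldots)$ belongs to $E$, and (ii) $\mathcal K_n\le1=\mathcal K_0$ for all $n$. Reality strongly complies with $E$ if such an $\mathcal R$ exists. *)

(* Defs.v *)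
From HB Require Import structures.
From mathcomp Require Import all_boot all_order all_algebra.
From mathcomp Require Import all_classical all_reals all_analysis.

Set Implicit Arguments.
Unset Strict Implicit.
Unset Printing Implicit Defensive.

Import Order.TTheory GRing.Theory Num.Theory.
Import numFieldNormedType.Exports.

Local Open Scope classical_set_scope.
Local Open Scope ring_scope.

(* Rounds are numbered from 0: the index [n] stands for round n + 1 of the
   game, except in [capital], where index [n] is the capital after n rounds. *)

Section UFGH.
Variable R : realType.

(* Forecaster's move (m, v) with v > 0, and Skeptic's move (M, V) with
   V >= 0; the sign constraints are carried by the types. *)
Definition forecast : Type := (R * {posnum R})%type.
Definition bet : Type := (R * {nonneg R})%type.

Definition fmean (f : forecast) : R := f.1.
Definition fvar (f : forecast) : R := f.2%:num.
Definition bmean (b : bet) : R := b.1.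
Definition bvar (b : bet) : R := b.2%:num.

Definition game_path : Type := nat -> forecast * R.
Definition event : Type := set game_path.

Definition path_m (xi : game_path) n : R := fmean (xi n).1.
Definition path_v (xi : game_path) n : R := fvar (xi n).1.
Definition path_x (xi : game_path) n : R := (xi n).2.

Definition event_imp (E1 E2 : event) : event := ~` E1 `|` E2.

Fixpoint capital (h : R -> R) (xi : game_path) (b : nat -> bet) n : R :=
  if n is k.+1 then
    capital h xi b k
    + bmean (b k) * (path_x xi k - path_m xi k)
    + bvar (b k) * (h (path_x xi k - path_m xi k) - path_v xi k)
  else 1.

(* A list of length n (n >= 1) is the history of the moves of Forecaster and
   Skeptic in the first n rounds, so a function on lists encodes the whole
   sequence of Reality's move functions (its value on [::] is never used). *)
Definition reality_strategy : Type := seq (forecast * bet) -> R.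

Definition outcome (rho : reality_strategy) (f : nat -> forecast)
    (b : nat -> bet) : game_path :=
  fun n => (f n, rho (mkseq (fun k => (f k, b k)) n.+1)).

Definition strongly_complies_by (h : R -> R) (rho : reality_strategy)
    (E : event) : Prop :=
  forall (f : nat -> forecast) (b : nat -> bet),
    let xi := outcome rho f b in
    (forall n, 0 <= capital h xi b n) ->
    E xi /\ (forall n, capital h xi b n <= 1).

Definition strongly_complies (h : R -> R) (E : event) : Prop :=
  exists rho : reality_strategy, strongly_complies_by h rho E.

(* Inverse of the restriction of h to [0, +oo[ (0 outside its range). *)
Definition hedge_inv (h : R -> R) : R -> R :=
  'pinv_(fun=> 0) [set x : R | 0 <= x] h.

Definition cumul_v (xi : game_path) n : R := \sum_(k < n.+1) path_v xi k.

Definition v_series_diverges (g : R -> R) : event :=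
  [set xi | (\sum_(0 <= n <oo) (path_v xi n / g (cumul_v xi n))%:E = +oo)%E].

(* [cvgn] in R is convergence to a finite limit. *)
Definition normed_sum_not_cvg (h g : R -> R) : event :=
  [set xi | ~ cvgn (series (fun k =>
     (path_x xi k - path_m xi k) / hedge_inv h (g (cumul_v xi k))))].

End UFGH.

(* Main.v *)
Require Import Defs.
From mathcomp Require Import all_boot all_order all_algebra.
From mathcomp Require Import all_classical all_reals all_analysis.
From mathcomp Require Import ring lra.

Set Implicit Arguments.
Unset Strict Implicit.
Unset Printing Implicit Defensive.

Import Order.TTheory GRing.Theory Num.Theory.
Import numFieldNormedType.Exports.
Local Open Scope ring_scope.

(** Write [D] for Skeptic's loss so far, one minus his capital, and, in the
    current round, [v] and [(M, V)] for the price and the bet, [G] for [g (A_n)]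
    and [b] for [h^-1 (G)].  If Reality moves the outcome by [y] away from the
    forecast mean, the loss grows by [V (v - h y) - M y].

    Suppose [D > 0].  Staying at the mean ([y = 0]) adds [V v] to the loss; a
    jump ([y = b] or [y = - b], whichever does not favour [M]) costs at most
    [V G], because [h b = G].  Reality stays if [D <= 2 G V], which multiplies
    the loss by at least [1 + v / (2 G)]; otherwise she jumps, and keeps more
    than half of the loss.  So a positive loss stays positive.  If she jumps
    only finitely often, the loss is eventually multiplied in every round by at
    least [1 + v / (2 G)]; it cannot exceed 1, since capital is nonnegative, so
    the sum of [v_n / g (A_n)] converges.  If she jumps infinitely often,
    infinitely many normalized deviations are [1] or [-1] and their series does
    not converge.

    This is [jump_or_grow], together with [growth_bounds_sum].

    It remains to start from loss zero ([loss_start]).  There any genuine bet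
    can be made to lose strictly: against [M <> 0], move against it by
    [h^-1 (v)], where the hedge term vanishes; against [M = 0 < V], stay at the
    mean.  Against the null bet a jump costs nothing.  So a loss that remains
    zero for ever means a jump in every round, and again no convergence.

    All this uses of [h^-1] is that it is a positive right inverse of [h] on
    the positive reals, which follows from [hedge_surj]. *)

(** * The inverse of the hedge *)

Section Hedge.
Variables (R : realType) (h : R -> R).
Hypothesis h_neq0 : exists x : R, h x <> 0.
Hypothesis h0 : h 0 = 0.
Hypothesis hA0 : forall x : R, h x = h `|x| /\ 0 <= h x.
Hypothesis hA1 : forall x y : R, 0 < x -> x <= y -> h x / x <= h y / y.
Hypothesis hA2 :
  forall x y : R, 0 < x -> x <= y -> h y / y ^+ 2 <= h x / x ^+ 2.

(** If [h x] vanished, (A2) would carry the zero to the right of [x] and (A1)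
    to its left. *)
Lemma hedge_gt0 (x : R) : 0 < x -> 0 < h x.
Proof.
move=> x0; rewrite lt_neqAle (hA0 x).2 andbT eq_sym; apply/eqP => hx0.
case: h_neq0 => z; rewrite (hA0 z).1 => hz; apply: hz.
have [->|z0] := eqVneq z 0; first by rewrite normr0.
have nz0 : 0 < `|z| by rewrite normr_gt0.
apply/eqP; rewrite eq_le (hA0 `|z|).2 andbT.
have [xz|/ltW zx] := leP x `|z|.
  by have := hA2 x0 xz; rewrite hx0 mul0r ler_pdivrMr ?exprn_gt0// mul0r.
by have := hA1 nz0 zx; rewrite hx0 mul0r ler_pdivrMr// mul0r.
Qed.

(** The supremum [s] of the sublevel set [h <= y] is a solution: (A2) bounds
    the growth of [h] by that of the square, so moving from [s] by the factor
    [sqrt (y / h s)] cannot cross the level [y]. *)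
Lemma hedge_surj (y : R) : 0 < y -> exists2 x : R, 0 <= x & h x = y.
Proof.
move=> y0; pose S := [set t : R | 0 <= t /\ h t <= y]%classic.
have h1 : 0 < h 1 by apply: hedge_gt0.
pose t0 := Num.min 1 (y / h 1).
have t00 : 0 < t0 by rewrite /t0 lt_min ltr01 divr_gt0.
have St0 : S t0.
  split; first exact: ltW.
  have t01 : t0 <= 1 by rewrite /t0 ge_min lexx.
  have := hA1 t00 t01; rewrite divr1 ler_pdivrMr// => /le_trans; apply.
  have : t0 <= y / h 1 by rewrite /t0 ge_min lexx orbT.
  by rewrite ler_pdivlMr// mulrC.
have ubS : has_ubound S.
  exists (Num.max 1 (y / h 1)) => t [t_ge0 ht].
  rewrite le_max; have [//|/ltW t1] := leP t 1; apply/orP; right.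
  have t_gt0 : 0 < t by apply: lt_le_trans t1.
  have := hA1 ltr01 t1; rewrite divr1 ler_pdivlMr// => ht1.
  by rewrite ler_pdivlMr// mulrC (le_trans ht1).
have supS : has_sup S by split => //; exists t0.
pose s := sup S.
have s_gt0 : 0 < s by apply: lt_le_trans t00 _; exact: ub_le_sup.
have hs := hedge_gt0 s_gt0.
pose r := Num.sqrt (y / h s).
have r2 : r ^+ 2 = y / h s by rewrite sqr_sqrtr// divr_ge0// ltW.
have r0 : 0 < r by rewrite sqrtr_gt0 divr_gt0.
have hsr2 : h s * r ^+ 2 = y by rewrite r2 mulrC divfK// gt_eqF.
exists s; first exact: ltW.
have [lt_sy|lt_ys|//] := ltgtP (h s) y.
  have r1 : 1 < r by rewrite -sqrtr1 ltr_sqrt ?divr_gt0// ltr_pdivlMr// mul1r.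
  have ssr : s < s * r by rewrite ltr_pMr.
  have : S (s * r).
    split; first by rewrite mulr_ge0// ltW.
    have := hA2 s_gt0 (ltW ssr).
    rewrite ler_pdivrMr ?exprn_gt0 ?mulr_gt0// exprMn mulrA divfK ?hsr2//.
    by rewrite expf_neq0// gt_eqF.
  by move=> /(ub_le_sup ubS); rewrite leNgt ssr.
have r1 : r < 1 by rewrite -sqrtr1 ltr_sqrt// ltr_pdivrMr// mul1r.
have srs : 0 < s - s * r by rewrite subr_gt0 gtr_pMr.
have [u [u_ge0 hu]] := sup_adherent srs supS; rewrite -/s subKr => sru.
have u0 : 0 < u by apply: lt_trans sru; rewrite mulr_gt0.
have us : u <= s by exact: ub_le_sup.
have := hA2 u0 us; rewrite ler_pdivlMr ?exprn_gt0// mulrAC.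
rewrite ler_pdivrMr ?exprn_gt0// => hsu.
have : h s * (s * r) ^+ 2 < h s * u ^+ 2.
  by rewrite ltr_pM2l// ltrXn2r// ltW// mulr_gt0.
rewrite exprMn mulrCA hsr2 mulrC => /lt_le_trans/(_ hsu).
by rewrite ltr_pM2r ?exprn_gt0// ltNge hu.
Qed.

Lemma hedge_invK (y : R) : 0 < y -> h (hedge_inv h y) = y.
Proof.
move=> /hedge_surj[x x0 hx]; rewrite /hedge_inv pinvK// inE.
by exists x.
Qed.

Lemma hedge_inv_gt0 (y : R) : 0 < y -> 0 < hedge_inv h y.
Proof.
move=> y0; rewrite lt_neqAle; apply/andP; split.
  apply/eqP => /esym e; have := hedge_invK y0.
  by rewrite e h0 => /eqP; rewrite lt_eqF.
have [x x0 hx] := hedge_surj y0.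
have surj : set_surj [set x : R | 0 <= x]%classic [set y]%classic h.
  by move=> _ ->; exists x.
by apply: (surjpinv_image_sub (dflt := fun=> 0) surj); exists y.
Qed.

End Hedge.

(** * One round *)

(** [D], [v], [M], [V] and [G] are as at the top of the file, [b] stands for
    [h^-1 (G)] and [c] for [h^-1 (v)]. *)
Definition deviation {R : realType} (D G b c M V : R) : R :=
  if D == 0 then
    if M != 0 then - Num.sg M * c else if V == 0 then b else 0
  else if D <= 2 * G * V then 0
  else if 0 <= M then - b else b.

Section Round.
Variables (R : realType) (h : R -> R) (D G b c M V v : R).
Hypotheses (h0 : h 0 = 0) (h_even : forall x, h x = h `|x|).
Hypotheses (v_gt0 : 0 < v) (G_gt0 : 0 < G) (b_gt0 : 0 < b) (c_gt0 : 0 < c).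
Hypotheses (hb : h b = G) (hc : h c = v) (V_ge0 : 0 <= V).

Let y := deviation D G b c M V.
Let D' := D - M * y - V * (h y - v).

Lemma loss_start : D = 0 -> D' = 0 /\ y = b \/ 0 < D'.
Proof.
rewrite /D' /y /deviation => D0; rewrite D0 eqxx; have [M0|M0] /= := eqVneq M 0.
  have [V0|V0] := eqVneq V 0.
    by left; split=> //; rewrite M0 V0 !mul0r !subr0.
  right; rewrite h0 M0 mul0r !sub0r oppr0 add0r mulrN opprK mulr_gt0//.
  by rewrite lt_neqAle eq_sym V0.
right; rewrite h_even mulNr normrN normrM normr_sg M0 mul1r (gtr0_norm c_gt0) hc.
rewrite subrr mulr0 subr0 sub0r mulrN opprK mulrA [M * _]mulrC -normrEsg.
by rewrite mulr_gt0 ?normr_gt0.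
Qed.

Lemma jump_or_grow : 0 < D ->
  0 < D' /\ (`|y| = b \/ D + D * (v / (2 * G)) <= D').
Proof.
move=> D0; rewrite /D' /y /deviation gt_eqF//.
have [DV|DV] := leP D (2 * G * V).
  have grow : D + D * (v / (2 * G)) <= D - M * 0 - V * (h 0 - v).
    rewrite mulr0 subr0 h0 sub0r mulrN opprK lerD2l mulrCA mulrC.
    by rewrite ler_pM2r// ler_pdivrMr ?mulr_gt0// mulrC.
  split; last by right.
  by apply: lt_le_trans grow; rewrite addr_gt0// mulr_gt0// divr_gt0// mulr_gt0.
have hb' : h (- b) = G by rewrite h_even normrN -h_even.
have Vv : 0 <= V * v by rewrite mulr_ge0// ltW.
have VG : 0 <= V * G by rewrite mulr_ge0// ltW.
have [M0|M0] := leP 0 M; split; try by left; rewrite ?normrN gtr0_norm.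
  have Mb : 0 <= M * b by rewrite mulr_ge0// ltW.
  by rewrite hb'; lra.
have Mb : M * b <= 0 by rewrite mulr_le0_ge0// ltW.
by rewrite hb; lra.
Qed.

End Round.

(** * Reality's strategy *)

Section Strategy.
Variables (R : realType) (h g : R -> R).

(** The state after a round holds Skeptic's capital, the cumulated price [A]
    and the move that Reality has just made.  Carrying that move lets her
    strategy, a function of the history of her opponents only, recompute her
    own earlier moves. *)
Definition reality_step (s : R * R * R) (fb : forecast R * bet R) : R * R * R :=
  let: (K, A, _) := s in
  let: (f, b) := fb in
  let A' := A + fvar f in
  let y := deviation (1 - K) (g A') (hedge_inv h (g A')) (hedge_inv h (fvar f))
    (bmean b) (bvar b) in
  (K + bmean b * y + bvar b * (h y - fvar f), A', fmean f + y).

Definition reality_play : reality_strategy R :=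
  fun hist => (foldl reality_step (1, 0, 0) hist).2.

Section Outcome.
Variables (f : nat -> forecast R) (b : nat -> bet R).
Let xi := outcome reality_play f b.

Definition play_deviation n : R :=
  deviation (1 - capital h xi b n) (g (cumul_v xi n))
    (hedge_inv h (g (cumul_v xi n))) (hedge_inv h (path_v xi n))
    (bmean (b n)) (bvar (b n)).

Lemma reality_play_dev n : path_x xi n - path_m xi n = play_deviation n.
Proof.
pose st k := foldl reality_step (1, 0, 0) (mkseq (fun k => (f k, b k)) k).
have stS k : st k.+1 = reality_step (st k) (f k, b k).
  by rewrite /st mkseqS foldl_rcons.
have stE k : (st k).1 = (capital h xi b k, \sum_(i < k) path_v xi i) /\
  path_x xi k - path_m xi k = play_deviation k.
  have dev j : (st j).1 = (capital h xi b j, \sum_(i < j) path_v xi i) ->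
      path_x xi j - path_m xi j = play_deviation j.
    rewrite /play_deviation /cumul_v {1}/path_x /= /reality_play -/(st j.+1) stS.
    case: (st j) => [[K A] x] /= [-> ->].
    by rewrite big_ord_recr/= /path_m /= addrAC subrr add0r.
  elim: k => [|k [IH IHdev]].
    have e : (st 0).1 = (capital h xi b 0, \sum_(i < 0) path_v xi i).
      by rewrite /st /= big_ord0.
    by split=> //; exact: dev.
  suff e : (st k.+1).1 = (capital h xi b k.+1, \sum_(i < k.+1) path_v xi i).
    by split=> //; exact: dev.
  rewrite stS /= IHdev /play_deviation /cumul_v.
  case: (st k) IH => [[K A] x] /= [-> ->].
  by rewrite big_ord_recr.
by have [] := stE n.
Qed.

End Outcome.
End Strategy.

(** * Series with nonnegative terms *)

Lemma bounded_nneseries_neq_pinfty (R : realType) (u : nat -> R) (C : R) :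
  (forall n, 0 <= u n) -> (forall n, \sum_(0 <= k < n) u k <= C) ->
  (\sum_(0 <= n <oo) (u n)%:E <> +oo)%E.
Proof.
move=> u0 uC uoo.
suff : (\sum_(0 <= n <oo) (u n)%:E <= C%:E)%E by rewrite uoo.
apply: lime_le; first by apply: is_cvg_nneseries => n _ _; rewrite lee_fin.
by apply: nearW => n; rewrite sumEFin lee_fin.
Qed.

(** A bounded sequence that is eventually multiplied by at least [1 + w n]
    gains at least its starting value times [w n] in every round. *)
Lemma growth_bounds_sum (R : realType) (D w : nat -> R) (N : nat) :
  (forall n, 0 <= w n) -> 0 < D N -> (forall n, D n <= 1) ->
  (forall n, (N <= n)%N -> D n + D n * w n <= D n.+1) ->
  exists C, forall n, \sum_(0 <= k < n) w k <= C.
Proof.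
move=> w0 DN D1 Dgrow; exists (\sum_(0 <= k < N) w k + (D N)^-1).
have grow j : D N + D N * \sum_(N <= k < N + j) w k <= D (N + j)%N.
  elim: j => [|j IH]; first by rewrite addn0 big_geq// mulr0 addr0.
  have DNj : D N <= D (N + j)%N.
    apply: le_trans IH; rewrite lerDl mulr_ge0 ?(ltW DN)//.
    by rewrite sumr_ge0.
  rewrite addnS big_nat_recr ?leq_addr//= mulrDr addrA.
  apply: le_trans (Dgrow _ (leq_addr _ _)).
  by rewrite lerD// ler_wpM2r.
have tail n : (N <= n)%N -> \sum_(N <= k < n) w k <= (D N)^-1.
  move=> Nn; have := le_trans (grow (n - N)%N) (D1 _); rewrite subnKC// => le1.
  rewrite -[leRHS]mul1r ler_pdivlMr// mulrC; apply: le_trans le1.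
  by rewrite lerDr ltW.
move=> n; have [Nn|/ltnW nN] := leqP N n.
  by rewrite (big_cat_nat (leq0n N) Nn)//= lerD2l tail.
rewrite [X in _ <= X + _](big_cat_nat (leq0n n) nN)//= -addrA lerDl addr_ge0//.
  by rewrite sumr_ge0.
by rewrite invr_ge0 ltW.
Qed.

(** * Strong compliance *)

Theorem theorem5p9 (R : realType) (h g : R -> R)
  (h_neq0 : exists x : R, h x <> 0)
  (h0 : h 0 = 0)
  (hA0 : forall x : R, h x = h `|x| /\ 0 <= h x)
  (hA1 : forall x y : R, 0 < x -> x <= y -> h x / x <= h y / y)
  (hA2 : forall x y : R, 0 < x -> x <= y -> h y / y ^+ 2 <= h x / x ^+ 2)
  (g_gt0 : forall t : R, 0 <= t -> 0 < g t)
  (g_incr : forall s t : R, 0 <= s -> s <= t -> g s <= g t) :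
  strongly_complies h
    (event_imp (v_series_diverges g) (normed_sum_not_cvg h g)).
Proof.
exists (reality_play h g) => f b xi K_ge0.
pose D n := 1 - capital h xi b n.
pose G n := g (cumul_v xi n).
pose B n := hedge_inv h (G n).
pose y n := play_deviation h g f b n.
have v_gt0 n : 0 < path_v xi n by rewrite /path_v /fvar.
have G_gt0 n : 0 < G n by apply: g_gt0; apply: sumr_ge0 => k _; exact: ltW.
have inv_gt0 := hedge_inv_gt0 h_neq0 h0 hA0 hA1 hA2.
have invK := hedge_invK h_neq0 h0 hA0 hA1 hA2.
have h_even x : h x = h `|x| by have [] := hA0 x.
have B_gt0 n : 0 < B n by exact: inv_gt0.
have V_ge0 n : 0 <= bvar (b n) by rewrite /bvar.
have yE n : path_x xi n - path_m xi n = y n by exact: reality_play_dev.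
have DS n : D n.+1 =
    D n - bmean (b n) * y n - bvar (b n) * (h (y n) - path_v xi n).
  by rewrite /D /= yE; ring.
have start n : D n = 0 -> D n.+1 = 0 /\ y n = B n \/ 0 < D n.+1.
  move=> Dn; rewrite DS.
  exact: (loss_start _ _ _ h0 h_even (v_gt0 n) (inv_gt0 _ (v_gt0 n))
    (invK _ (v_gt0 n)) (V_ge0 n) Dn).
have step n : 0 < D n -> 0 < D n.+1 /\
    (`|y n| = B n \/ D n + D n * (path_v xi n / (2 * G n)) <= D n.+1).
  move=> Dn; rewrite DS.
  exact: (jump_or_grow _ _ h0 h_even (v_gt0 n) (G_gt0 n) (B_gt0 n)
    (invK _ (G_gt0 n)) (V_ge0 n) Dn).
have D_ge0 n : 0 <= D n.
  elim: n => [|n]; first by rewrite /D /= subrr.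
  rewrite le_eqVlt => /predU1P[/esym/start[[-> _]//|/ltW//]|].
  by move=> /step[/ltW].
split; last by move=> n; rewrite -subr_ge0; exact: D_ge0.
have [div|] := pselect (v_series_diverges g xi); last by left.
right => /= /cvg_series_cvg_0 /cvgr0_norm_lt /(_ _ ltr01) [N _ smallN].
have no_jump n : (N <= n)%N -> `|y n| <> B n.
  move=> Nn yB; have := smallN n Nn; rewrite /= yE normrM yB normfV.
  by rewrite (gtr0_norm (B_gt0 n)) divff ?ltxx// gt_eqF.
(* A loss still zero in round N turns positive there, as every null bet is met
   by a jump. *)
have [N' NN' DN'] : exists2 N', (N <= N')%N & 0 < D N'.
  have := D_ge0 N; rewrite le_eqVlt => /predU1P[/esym/start[[_ yB]|DN]|DN].
  - by case: (no_jump N (leqnn _)); rewrite yB gtr0_norm.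
  - by exists N.+1.
  - by exists N.
have Dpos j : 0 < D (N' + j)%N.
  by elim: j => [|j /step[]]; rewrite ?addn0 ?addnS.
have [] := @growth_bounds_sum _ D (fun n => path_v xi n / (2 * G n)) N'.
- by move=> n; rewrite divr_ge0 ?mulr_ge0// ltW.
- exact: DN'.
- by move=> n; rewrite /D gerBl.
- move=> n Nn; have := Dpos (n - N')%N; rewrite subnKC// => /step[_ [yB|//]].
  by case: (no_jump n (leq_trans NN' Nn)).
move=> C vC; have vG0 n : 0 <= path_v xi n / G n.
  by rewrite divr_ge0// ltW.
apply: (bounded_nneseries_neq_pinfty (C := 2 * C) vG0 _ div) => n.
rewrite (eq_bigr (fun k => 2 * (path_v xi k / (2 * G k)))) => [|k _].
  by rewrite -mulr_sumr ler_pM2l.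
by field; rewrite gt_eqF.
Qed.
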